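(* Suppose all subsystems have the same state dimension ($n_i=n_j$ for all $i,j$). Consider the semidefinite program in the variables $G$, $S^i$, $Y^i$, $Y^{i,j}$ ($j\in\mathcal{N}^i\setminus\{i\}$), $\tilde W^{\mathcal{N}^i}$, $\mu_i$ ($i=1,\dots,M$) and $\delta$: $$\min\ \delta$$ subject to, for all $i=1,\dots,M$, $$\begin{bmatrix} G^{\mathcal{N}^i}+(G^{\mathcal{N}^i})^T-S^{\mathcal{N}^i}+\tilde W^{\mathcal{N}^i} & (T^{\mathcal{N}^i})^T & (T^i)^T\\ T^{\mathcal{N}^i} & S^{\mathcal{N}^i} & 0\\ T^i & 0 & I\end{bmatrix}\succ0,$$ $$Y^{i,j}=Y^j\quad\forall j\in\mathcal{N}^i\setminus\{i\},\qquad \tilde W\preceq\delta I.$$ If this program has an optimal value $\delta^*\le0$, then the following holds: there exist a neighborhood of the origin $\Omega\subseteq\mathbb{R}^n$, a stabilizing feedback law $\kappa$ for $x_{t+1}=Ax_t+Bu_t$ and a terminal cost $\ell_{\rm f}$, of the form $\kappa(x)=Fx$ with $F=\mathrm{diag}(F^1,\dots,F^M)$ and $\ell_{\rm f}(x)=\sum_{i=1}^M (x^i)^TP^ix^i$ with $P^i\succ0$, where $P^i$ and $F^i$ are related to the variables of the program by $P^i=(S^i)^{-1}$ and $F^i=Y^iG^{-1}$, such that $$\ell_{\rm f}(Ax+B\kappa(x))-\ell_{\rm f}(x)+\kappa(x)^TR\,\kappa(x)+x^TQx\le0\quad\forall x\in\Omega,$$ and $\kappa(x)\in U^1\times\cdots\times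 U^M$ and $Ax+B\kappa(x)\in\Omega$ for all $x\in\Omega$.
   Context: Network system: for $i=1,\dots,M$, $x^i_{t+1}=\sum_{j\in\mathcal{N}^i}(A^{ij}x^j_t+B^{ij}u^j_t)$, with $x^i_t\in\mathbb{R}^{n_i}$, $u^i_t\in\mathbb{R}^{m_i}$, where $\mathcal{N}^i\subseteq\{1,\dots,M\}$ contains $i$ and the indices of its neighbors. Overall system: $x_{t+1}=Ax_t+Bu_t$, $x=[(x^1)^T\cdots(x^M)^T]^T\in\mathbb{R}^n$, $u=[(u^1)^T\cdots(u^M)^T]^T\in\mathbb{R}^m$, $n=\sum_i n_i$, $m=\sum_i m_i$ (blocks $A^{ij},B^{ij}$ are zero for $j\notin\mathcal{N}^i$). Input constraint sets $U^i\subseteq\mathbb{R}^{m_i}$ are compact and convex with the origin in their interior. $Q=\mathrm{diag}(Q^1,\dots,Q^M)$ and $R=\mathrm{diag}(R^1,\dots,R^M)$ with symmetric $Q^i\succeq0$, $R^i\succ0$. A stabilizing feedback law is one for which the closed-loop system $x_{t+1}=Ax_t+B\kappa(x_t)$ is asymptotically stable at the origin. Neighborhood vectors: $x^{\mathcal{N}^i}=[(x^j)^T,\ j\in\mathcal{N}^i]^T\in\mathbb{R}^{n_{\mathcal{N}^i}}$ and $u^{\mathcal{N}^i}=[(u^j)^T,\ j\in\mathcal{N}^i]^T\in\mathbb{R}^{m_{\mathcal{N}^i}}$, where $n_{\mathcal{N}^i}=\sum_{j\in\mathcal{N}^i}n_j$, $m_{\mathcal{N}^i}=\sum_{j\in\mathcal{N}^i}m_j$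 and index $i$ is listed first. Selection matrices $E_n^i,E_m^i,J_n^{\mathcal{N}^i},J_m^{\mathcal{N}^i}$ are defined by $x^i=E_n^ix$, $u^i=E_m^iu$, $x^{\mathcal{N}^i}=J_n^{\mathcal{N}^i}x$, $u^{\mathcal{N}^i}=J_m^{\mathcal{N}^i}u$. Set $A^{\mathcal{N}^i}=E_n^iA(J_n^{\mathcal{N}^i})^T$ and $B^{\mathcal{N}^i}=E_n^iB(J_m^{\mathcal{N}^i})^T$. SDP variables: $G\in\mathbb{R}^{n_i\times n_i}$ (common to all subsystems), symmetric $S^i\in\mathbb{R}^{n_i\times n_i}$, $Y^i\in\mathbb{R}^{m_i\times n_i}$, $Y^{i,j}\in\mathbb{R}^{m_j\times n_j}$, symmetric $\tilde W^{\mathcal{N}^i}\in\mathbb{R}^{n_{\mathcal{N}^i}\times n_{\mathcal{N}^i}}$, scalars $\mu_i,\delta\in\mathbb{R}$. Derived matrices ($\otimes$ is the Kronecker product, $|\mathcal{N}^i|$ the cardinality, $0$ blocks of appropriate size): $G^{\mathcal{N}^i}=I_{|\mathcal{N}^i|}\otimes G$; $G^{\mathcal{N}^i\setminus i}=[\,0\ \ I_{|\mathcal{N}^i|-1}\otimes G\,]$; $S^{\mathcal{N}^i}=\mathrm{diag}(S^i,\mu_iI_{n_{\mathcal{N}^i}-n_i})$; $Y^{\mathcal{N}^i}=\mathrm{diag}(Y^i,Y^{i,j}: j\in\mathcal{N}^i\setminus\{i\})$ (block diagonal); $$T^{\mathcal{N}^i}=\begin{bmatrix}A^{\mathcal{N}^i}G^{\mathcal{N}^i}+B^{\mathcal{N}^i}Y^{\mathcal{N}^i}\\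 G^{\mathcal{N}^i\setminus i}\end{bmatrix},\qquad T^i=\begin{bmatrix}(Q^i)^{1/2}G&0\\(R^i)^{1/2}Y^i&0\end{bmatrix}.$$ The global matrix $\tilde W\in\mathbb{R}^{n\times n}$ is assembled from the local ones by $x^T\tilde Wx=\sum_{i=1}^M(x^{\mathcal{N}^i})^T\tilde W^{\mathcal{N}^i}x^{\mathcal{N}^i}$ for all $x$, i.e. $\tilde W=\sum_{i=1}^M(J_n^{\mathcal{N}^i})^T\tilde W^{\mathcal{N}^i}J_n^{\mathcal{N}^i}$.
   Formalization: ''Optimal value δ* ≤ 0'' is replaced by ''a feasible point with δ ≤ 0'', from which P^i and F^i are computed; the infimum is always ≤ 0 by scaling (even for M=1, A=2, B=0, not stabilizable), and no minimum is attained because the matrix inequalities are strict. *)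

(* Defs.v *)
(* MathComp / MathComp-Analysis *)
From HB Require Import structures.
From mathcomp Require Import all_boot all_order all_algebra.
From mathcomp Require Import all_classical all_reals all_analysis.

Set Implicit Arguments.
Unset Strict Implicit.
Unset Printing Implicit Defensive.

Import Order.TTheory GRing.Theory Num.Theory.
Import numFieldNormedType.Exports.

Local Open Scope classical_set_scope.
Local Open Scope ring_scope.

Section PositiveDefinite.
Variable R : realType.

Definition qform n (X : 'M[R]_n) (x : 'cV[R]_n) : R := (x^T *m X *m x) 0 0.

Definition psdmx n (X : 'M[R]_n) : Prop :=
  X^T = X /\ forall x : 'cV[R]_n, 0 <= qform X x.

Definition pdmx n (X : 'M[R]_n) : Prop :=
  X^T = X /\ forall x : 'cV[R]_n, x != 0 -> 0 < qform X x.

(* H is the principal square root of X; it exists and is unique as soon as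
   X is positive semidefinite. *)
Definition is_sqrtmx n (X H : 'M[R]_n) : Prop := psdmx H /\ H *m H = X.

End PositiveDefinite.

(* Rectangular blocks, unlike \mxdiag; all blocks have d columns. *)
Definition blockdiag (R : nmodType) (k d : nat) (r : 'I_k -> nat)
    (X : forall i : 'I_k, 'M[R]_(r i, d)) :
    'M[R]_(\sum_(i < k) r i, \sum_(j < k) d) :=
  \mxblock_(i < k, j < k) (if i == j then X i else 0).

Definition asymptotically_stable (V : topologicalType) (f : V -> V) (x0 : V) :
    Prop :=
  [/\ f x0 = x0,
      forall O : set V, nbhs x0 O ->
        \forall x \near x0, forall t : nat, O (iter t f x)
    & \forall x \near x0, iter t f x @[t --> \oo] --> x0].

Definition closed_loop (R : realType) (n m : nat) (A : 'M[R]_n)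
    (B : 'M[R]_(n, m)) (kappa : 'cV[R]_n -> 'cV[R]_m) (x : 'cV[R]_n) :
    'cV[R]_n :=
  A *m x + B *m kappa x.

Definition stabilizing (R : realType) (n m : nat) (A : 'M[R]_n)
    (B : 'M[R]_(n, m)) (kappa : 'cV[R]_n -> 'cV[R]_m) : Prop :=
  asymptotically_stable (closed_loop A B kappa) 0.

(* M subsystems with common state dimension d; subsystem i has input dimension
   mi i and neighborhood N i, which contains i. *)
Section Network.
Variables (R : realType) (M d : nat) (mi : 'I_M -> nat) (N : 'I_M -> {set 'I_M}).

(* Neighborhood vectors list subsystem i first, then the other neighbors in
   increasing order: the l-th one is enum_val l for l : 'I_(degN i). *)
Definition degN (i : 'I_M) : nat := #|N i :\ i|.
Definition nbr (i : 'I_M) (l : 'I_(degN i)) : 'I_M := enum_val l.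

Definition n_rest (i : 'I_M) : nat := (\sum_(l < degN i) d)%N.
Definition m_rest (i : 'I_M) : nat := (\sum_(l < degN i) mi (nbr l))%N.

Definition nbvec (r : 'I_M -> nat) (i : 'I_M) (x : 'cV[R]_(\sum_(j < M) r j)) :
    'cV[R]_(r i + \sum_(l < degN i) r (nbr l)) :=
  col_mx (submxcol x i) (\mxcol_(l < degN i) submxcol x (nbr l)).

Definition selE (r : 'I_M -> nat) (i : 'I_M) :
    'M[R]_(r i, \sum_(j < M) r j) := submxcol 1%:M i.

Definition selJ (r : 'I_M -> nat) (i : 'I_M) :
    'M[R]_(r i + \sum_(l < degN i) r (nbr l), \sum_(j < M) r j) :=
  col_mx (selE r i) (\mxcol_(l < degN i) selE r (nbr l)).

Lemma mul_selE (r : 'I_M -> nat) (i : 'I_M) (x : 'cV[R]_(\sum_(j < M) r j)) :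
  selE r i *m x = submxcol x i.
Proof. by rewrite /selE submxcol_mul mul1mx. Qed.

Lemma mul_selJ (r : 'I_M -> nat) (i : 'I_M) (x : 'cV[R]_(\sum_(j < M) r j)) :
  selJ r i *m x = nbvec i x.
Proof.
rewrite /selJ /nbvec mul_col_mx mul_selE mxcol_mul; congr col_mx.
by apply: eq_mxcol => l; rewrite mul_selE.
Qed.

Definition En (i : 'I_M) : 'M[R]_(d, \sum_(j < M) d) := selE (fun=> d) i.
Definition Jn (i : 'I_M) : 'M[R]_(d + n_rest i, \sum_(j < M) d) :=
  selJ (fun=> d) i.
Definition Jm (i : 'I_M) : 'M[R]_(mi i + m_rest i, \sum_(j < M) mi j) :=
  selJ mi i.

(* sdpYn i j stands for Y^{i,j}; only its values at j \in N i :\ i are used. *)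
Record sdp_vars := SdpVars {
  sdpG : 'M[R]_d;
  sdpS : 'I_M -> 'M[R]_d;
  sdpY : forall i : 'I_M, 'M[R]_(mi i, d);
  sdpYn : forall i j : 'I_M, 'M[R]_(mi j, d);
  sdpW : forall i : 'I_M, 'M[R]_(d + n_rest i);
  sdpmu : 'I_M -> R;
  sdpdelta : R }.

Variables (A : 'M[R]_(\sum_(i < M) d))
          (B : 'M[R]_(\sum_(i < M) d, \sum_(i < M) mi i)).

Definition AN (i : 'I_M) : 'M[R]_(d, d + n_rest i) := En i *m A *m (Jn i)^T.
Definition BN (i : 'I_M) : 'M[R]_(d, mi i + m_rest i) := En i *m B *m (Jm i)^T.

Section Constraints.
(* Principal square roots of the weights Q^i and R^i. *)
Variables (Qh : 'I_M -> 'M[R]_d) (Rh : forall i : 'I_M, 'M[R]_(mi i)).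
Variable v : sdp_vars.

(* I_{|N i| - 1} (x) G *)
Definition Grest (i : 'I_M) : 'M[R]_(n_rest i) := \mxdiag_(l < degN i) sdpG v.

Definition GN (i : 'I_M) : 'M[R]_(d + n_rest i) :=
  block_mx (sdpG v) 0 0 (Grest i).

Definition GNi (i : 'I_M) : 'M[R]_(n_rest i, d + n_rest i) :=
  row_mx 0 (Grest i).

Definition SN (i : 'I_M) : 'M[R]_(d + n_rest i) :=
  block_mx (sdpS v i) 0 0 (sdpmu v i)%:M.

Definition YN (i : 'I_M) : 'M[R]_(mi i + m_rest i, d + n_rest i) :=
  block_mx (sdpY v i) 0 0 (blockdiag (fun l : 'I_(degN i) => sdpYn v i (nbr l))).

Definition TN (i : 'I_M) : 'M[R]_(d + n_rest i, d + n_rest i) :=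
  col_mx (AN i *m GN i + BN i *m YN i) (GNi i).

Definition Ti (i : 'I_M) : 'M[R]_(d + mi i, d + n_rest i) :=
  block_mx (Qh i *m sdpG v) 0 (Rh i *m sdpY v i) 0.

Definition Wglobal : 'M[R]_(\sum_(i < M) d) :=
  \sum_(i < M) (Jn i)^T *m sdpW v i *m Jn i.

Definition lmi (i : 'I_M) :
    'M[R]_((d + n_rest i) + ((d + n_rest i) + (d + mi i))) :=
  block_mx (GN i + (GN i)^T - SN i + sdpW v i) (row_mx (TN i)^T (Ti i)^T)
           (col_mx (TN i) (Ti i))           (block_mx (SN i) 0 0 1%:M).

(* The program minimizes sdpdelta over the feasible points.  Every lmi is an
   open condition, so no feasible point is a minimizer, and scaling a feasible
   point by small positive factors shows that the infimum is always <= 0.  The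
   informative form of "the optimal value is <= 0" is therefore the existence
   of a feasible point with sdpdelta <= 0. *)
Definition sdp_feasible : Prop :=
  [/\ forall i, (sdpS v i)^T = sdpS v i,
      forall i, (sdpW v i)^T = sdpW v i,
      forall i, pdmx (lmi i),
      forall i j, j \in N i :\ i -> sdpYn v i j = sdpY v j
    & psdmx ((sdpdelta v)%:M - Wglobal)].

End Constraints.
End Network.

(* Main.v *)
Require Import Defs.
From HB Require Import structures.
From mathcomp Require Import all_boot all_order all_algebra.
From mathcomp Require Import all_classical all_reals all_analysis.
From mathcomp Require Import ring lra.

Set Implicit Arguments.
Unset Strict Implicit.
Unset Printing Implicit Defensive.

Import Order.TTheory GRing.Theory Num.Theory.
Import numFieldNormedType.Exports.

Local Open Scope classical_set_scope.
Local Open Scope ring_scope.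

(** The feasible matrices are read in the coordinates [y] with [x = G y] and
    [u = Y y].  The Schur complement of the linear matrix inequality of
    subsystem [i], evaluated at the neighborhood vector of [y], together with
    [G + G^T - S <= G^T S^-1 G] ([qform_slack]), gives with [P i = (S i)^-1]

      P_i (x+_i) + stage cost_i <= P_i (x_i) + W_i (y_{N i}),

    strictly unless the neighborhood vector vanishes ([lmi_local]); the
    contributions of the neighbors' states, weighted by [1 / mu], occur on both
    sides and cancel.  Summed over [i], the coupling terms form the global
    matrix, which is at most [delta I] and hence negative semidefinite, so the
    total terminal cost strictly decreases by more than the stage cost
    ([global_decrease]).  This forces [G] to be invertible ([sdpG_unit]), hence
    every state is of the form [G y], and the inequality holds for the closed
    loop with [F = Y G^-1] ([closed_loop_decrease]).

    The rest is a quadratic Lyapunov argument.  A diagonal entry of [X^-1]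
    bounds the square of a coordinate by the form of [X] ([pdmx_entry_le]), so
    sublevel sets of the terminal cost are a basis of neighborhoods of the
    origin ([nbhs0_qformP]) and its strict decrease is geometric
    ([lyapunov_contraction]), whence asymptotic stability
    ([lyapunov_stable]).  The set [Omega] is a sublevel set small enough for
    the inputs to stay in the constraint sets; it is invariant because the
    cost decreases. *)

(** * Positive definite quadratic forms *)

Section QuadraticForms.
Variable R : realType.

Lemma mxform_tr n p (X : 'M[R]_(n, p)) (x : 'cV[R]_n) (y : 'cV[R]_p) :
  (x^T *m X *m y) 0 0 = (y^T *m X^T *m x) 0 0.
Proof.
have -> : y^T *m X^T *m x = (x^T *m X *m y)^T by rewrite !trmx_mul trmxK mulmxA.
by rewrite [RHS]mxE.
Qed.

Lemma qform0 n (X : 'M[R]_n) : qform X 0 = 0.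
Proof. by rewrite /qform mulmx0 mxE. Qed.

Lemma qform0mx n (x : 'cV[R]_n) : qform 0 x = 0.
Proof. by rewrite /qform mulmx0 mul0mx mxE. Qed.

Lemma qformDmx n (X Y : 'M[R]_n) x : qform (X + Y) x = qform X x + qform Y x.
Proof. by rewrite /qform mulmxDr mulmxDl mxE. Qed.

Lemma qformBmx n (X Y : 'M[R]_n) x : qform (X - Y) x = qform X x - qform Y x.
Proof. by rewrite /qform mulmxBr mulmxBl !mxE. Qed.

Lemma qform_sum I r (P : pred I) n (X : I -> 'M[R]_n) x :
  qform (\sum_(i <- r | P i) X i) x = \sum_(i <- r | P i) qform (X i) x.
Proof.
by rewrite (big_morph (fun X => qform X x)
  (fun X Y => qformDmx X Y x) (qform0mx x)).
Qed.

Lemma qform_tr n (X : 'M[R]_n) x : qform X^T x = qform X x.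
Proof. by rewrite /qform -mxform_tr. Qed.

Lemma qform_cong n p (X : 'M[R]_n) (T : 'M[R]_(n, p)) x :
  qform (T^T *m X *m T) x = qform X (T *m x).
Proof. by rewrite /qform trmx_mul !mulmxA. Qed.

Lemma qformE n (X : 'M[R]_n) (x : 'cV[R]_n) :
  qform X x = \sum_j (\sum_i x i 0 * X i j) * x j 0.
Proof.
rewrite /qform mxE; apply: eq_bigr => j _; rewrite mxE.
by congr (_ * _); apply: eq_bigr => i _; rewrite mxE.
Qed.

Lemma qform_scalar n (a : R) (x : 'cV[R]_n) :
  qform a%:M x = a * \sum_i x i 0 ^+ 2.
Proof.
rewrite /qform mul_mx_scalar -scalemxAl mxE; congr (_ * _).
by rewrite mxE; apply: eq_bigr => i _; rewrite mxE expr2.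
Qed.

Lemma qformB n (X : 'M[R]_n) (a b : 'cV[R]_n) : X^T = X ->
  qform X (a - b) = qform X a - 2 * (a^T *m X *m b) 0 0 + qform X b.
Proof.
move=> Xs; have tB : (a - b)^T = a^T - b^T by exact: linearB.
have eB (Y Z : 'M[R]_1) : (Y - Z) 0 0 = Y 0 0 - Z 0 0 by rewrite !mxE.
rewrite /qform tB !mulmxBl !mulmxBr !eB.
have -> : (b^T *m X *m a) 0 0 = (a^T *m X *m b) 0 0 by rewrite mxform_tr Xs.
ring.
Qed.

Lemma qform_scale n (X : 'M[R]_n) (c : R) x :
  qform X (c *: x) = c ^+ 2 * qform X x.
Proof.
have tZ : (c *: x)^T = c *: x^T by exact: linearZ.
by rewrite /qform tZ -!scalemxAr -!scalemxAl !scalerA -expr2 mxE.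
Qed.

Lemma qform_block n p (X : 'M[R]_n) (T : 'M[R]_(p, n)) (S : 'M[R]_p) z w :
  qform (block_mx X T^T T S) (col_mx z w) =
  qform X z + 2 * (w^T *m (T *m z)) 0 0 + qform S w.
Proof.
have eD (Y Z : 'M[R]_1) : (Y + Z) 0 0 = Y 0 0 + Z 0 0 by rewrite !mxE.
rewrite /qform tr_col_mx mul_row_block mul_row_col !mulmxDl !eD !mulmxA.
have -> : (z^T *m T^T *m w) 0 0 = (w^T *m T *m z) 0 0.
  by rewrite mxform_tr trmxK.
ring.
Qed.

Lemma qform_block_diag n p (X : 'M[R]_n) (S : 'M[R]_p) z w :
  qform (block_mx X 0 0 S) (col_mx z w) = qform X z + qform S w.
Proof. by rewrite -{1}[0]trmx0 qform_block mul0mx mulmx0 mxE mulr0 addr0. Qed.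

Lemma qform_le_entries n (X : 'M[R]_n) (x : 'cV[R]_n) (b : R) :
  (forall i, x i 0 ^+ 2 <= b) ->
  qform X x <= (\sum_j \sum_i `|X i j|) * b.
Proof.
move=> xb; rewrite qformE mulr_suml; apply: ler_sum => j _.
rewrite !mulr_suml; apply: ler_sum => i _.
rewrite mulrAC mulrC; apply: (le_trans (ler_norm _)).
rewrite normrM; apply: ler_wpM2l; first exact: normr_ge0.
rewrite ler_norml; move: (xb i) (xb j).
move: (sqr_ge0 (x i 0 + x j 0)) (sqr_ge0 (x i 0 - x j 0)).
set p := x i 0; set q := x j 0 => s1 s2 pb qb; apply/andP; split; nra.
Qed.

Lemma pdmx_ge0 n (X : 'M[R]_n) x : pdmx X -> 0 <= qform X x.
Proof.
by move=> [_ X0]; have [->|/X0/ltW//] := eqVneq x 0; rewrite qform0.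
Qed.

Lemma pdmx_unit n (X : 'M[R]_n) : pdmx X -> X \in unitmx.
Proof.
move=> [Xs X0]; rewrite -row_free_unit -kermx_eq0.
apply/rowV0P => u /sub_kermxP uX.
apply/eqP/contraT => u0; have /X0 : u^T != 0 by rewrite trmx_eq0.
by rewrite /qform trmxK uX mul0mx mxE ltxx.
Qed.

Lemma pdmx_scalar1 n : pdmx (1%:M : 'M[R]_n).
Proof.
split=> [|x x0]; first exact: trmx1.
rewrite qform_scalar mul1r lt_neqAle eq_sym sumr_ge0 ?andbT; last first.
  by move=> i _; exact: sqr_ge0.
apply: contra x0; rewrite psumr_eq0 => [/allP x0|i _]; last exact: sqr_ge0.
apply/eqP/matrixP => i j; rewrite ord1 mxE; apply/eqP.
by rewrite -sqrf_eq0; exact: (x0 i (mem_index_enum i)).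
Qed.

Lemma qform_invmx n (X : 'M[R]_n) x : pdmx X ->
  qform (invmx X) x = qform X (invmx X *m x).
Proof.
move=> Xpd; have [Xs _] := Xpd; rewrite /qform trmx_mul trmx_inv Xs.
rewrite -[x^T *m invmx X *m X]mulmxA.
by rewrite mulVmx ?pdmx_unit// mulmx1 mulmxA.
Qed.

Lemma pdmx_inv n (X : 'M[R]_n) : pdmx X -> pdmx (invmx X).
Proof.
move=> Xpd; have [Xs X0] := Xpd; split=> [|x x0]; first by rewrite trmx_inv Xs.
rewrite qform_invmx//; apply: X0; apply: contra x0 => /eqP Xx.
by rewrite -[x]mul1mx -(mulmxV (pdmx_unit Xpd)) -mulmxA Xx mulmx0.
Qed.

Lemma pdmx_block_diag n p (X : 'M[R]_n) (Y : 'M[R]_p) :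
  pdmx (block_mx X 0 0 Y) -> pdmx X /\ pdmx Y.
Proof.
move=> [+ XY0]; rewrite tr_block_mx => /eq_block_mx[Xs _ _ Ys].
split; split=> // x x0.
- have := XY0 (col_mx x 0); rewrite qform_block_diag qform0 addr0; apply.
  by rewrite col_mx_eq0 negb_and x0.
- have := XY0 (col_mx 0 x); rewrite qform_block_diag qform0 add0r; apply.
  by rewrite col_mx_eq0 negb_and x0 orbT.
Qed.

Lemma qform_inv_block_diag n p (X : 'M[R]_n) (Y : 'M[R]_p) x y :
  pdmx (block_mx X 0 0 Y) ->
  qform (invmx (block_mx X 0 0 Y)) (col_mx x y) =
  qform (invmx X) x + qform (invmx Y) y.
Proof. by move/pdmx_unit/invmx_block_diag->; exact: qform_block_diag. Qed.

(** The form of the block matrix at [(z, - S^-1 T z)], the minimizer in the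
    second component, is the Schur complement form at [z].  The conditional
    equality keeps track of the only case [z = 0] in which strictness fails, so
    that the inequalities of all subsystems can be added. *)
Lemma schur_pdmx n p (X : 'M[R]_n) (T : 'M[R]_(p, n)) (S : 'M[R]_p) :
  pdmx (block_mx X T^T T S) ->
  pdmx S /\ forall z, qform (invmx S) (T *m z) <= qform X z ?= iff (z == 0).
Proof.
move=> [+ XS0]; rewrite tr_block_mx => /eq_block_mx[_ _ _ Ss].
have Spd : pdmx S.
  split=> // w w0; have := XS0 (col_mx 0 w).
  rewrite qform_block qform0 !mulmx0 mxE mulr0 !add0r; apply.
  by rewrite col_mx_eq0 negb_and w0 orbT.
split=> // z; have [->|z0] := eqVneq z 0.
  by rewrite mulmx0 !qform0; apply/leif_refl.
have := XS0 (col_mx z (- (invmx S *m (T *m z)))).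
rewrite col_mx_eq0 negb_and z0 => /(_ isT); rewrite qform_block.
have -> : qform S (- (invmx S *m (T *m z))) = qform (invmx S) (T *m z).
  by rewrite -scaleN1r qform_scale sqrrN expr1n mul1r qform_invmx.
rewrite linearN /= mulNmx mxE.
have -> : (invmx S *m (T *m z))^T *m (T *m z) =
          (T *m z)^T *m invmx S *m (T *m z) by rewrite trmx_mul trmx_inv Ss.
by rewrite -/(qform _ _) => lt0; split; [lra|apply/eqP; lra].
Qed.

(** Expansion of [0 <= qform S^-1 ((G - S) z)]. *)
Lemma qform_slack n (G S : 'M[R]_n) z : pdmx S ->
  qform (G + G^T - S) z <= qform (invmx S) (G *m z).
Proof.
move=> Spd; have [Ss _] := Spd; have [Is _] := pdmx_inv Spd.
have := pdmx_ge0 (G *m z - S *m z) (pdmx_inv Spd).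
rewrite qformB// !mulmxA -(mulmxA _ (invmx S)) mulVmx ?pdmx_unit// mulmx1.
have -> : qform (invmx S) (S *m z) = qform S z.
  by rewrite -qform_cong Ss mulmxV ?pdmx_unit// mul1mx.
rewrite qformBmx qformDmx qform_tr trmx_mul -/(qform G^T z) qform_tr; lra.
Qed.

(** Cauchy-Schwarz for the inner product of [X], applied to [x] and
    [X^-1 e_i]: their product is [x_i], and the squared length of [X^-1 e_i] is
    the diagonal entry [(X^-1)_ii].  It gives lower bounds on definite
    forms without an appeal to compactness of the sphere. *)
Lemma pdmx_entry_le n (X : 'M[R]_n) (x : 'cV[R]_n) i : pdmx X ->
  x i 0 ^+ 2 <= invmx X i i * qform X x.
Proof.
move=> Xpd; have [Xs X0] := Xpd.
pose e : 'cV[R]_n := delta_mx i 0; pose w := invmx X *m e.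
have e0 : e != 0.
  by apply/eqP => /matrixP/(_ i 0)/eqP; rewrite !mxE !eqxx oner_eq0.
have eX m (Y : 'M[R]_(n, m)) j : (e^T *m Y) 0 j = Y i j.
  by rewrite trmx_delta -rowE mxE.
have aE : invmx X i i = qform (invmx X) e.
  by rewrite /qform -colE mxE eX.
have wX : (x^T *m X *m w) 0 0 = x i 0.
  rewrite mxform_tr Xs trmx_mul trmx_inv Xs -(mulmxA e^T) mulVmx ?pdmx_unit//.
  by rewrite mulmx1 eX.
have a0 : 0 < invmx X i i by rewrite aE; exact: (pdmx_inv Xpd).2.
(* this multiple of the residual of x along w avoids dividing by (X^-1)_ii *)
have := pdmx_ge0 (invmx X i i *: x - x i 0 *: w) Xpd.
have xwE : ((invmx X i i *: x)^T *m X *m (x i 0 *: w)) 0 0 =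
    invmx X i i * x i 0 ^+ 2.
  have tZ : (invmx X i i *: x)^T = invmx X i i *: x^T by exact: linearZ.
  rewrite tZ -!scalemxAr -!scalemxAl scalerA mxE wX; ring.
rewrite qformB// !qform_scale xwE /w -qform_invmx// -aE => h.
rewrite -(ler_pM2l a0) -subr_ge0; lra.
Qed.

Lemma qform_sqrtmx n (X H : 'M[R]_n) x :
  is_sqrtmx X H -> qform 1%:M (H *m x) = qform X x.
Proof. by move=> [[Hs _] <-]; rewrite -qform_cong Hs mulmx1. Qed.

End QuadraticForms.

(** * Quadratic Lyapunov functions of linear maps *)

Section Lyapunov.
Variable R : realType.

(** All forms on a finite dimensional space are bounded by multiples of a
    definite one, with an explicit constant from [pdmx_entry_le]. *)
Lemma pdmx_dominates n (P D : 'M[R]_n) : pdmx D ->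
  exists2 k : R, 0 <= k & forall x, qform P x <= k * qform D x.
Proof.
move=> Dpd; pose s := \sum_j \sum_i `|P i j|; pose t := \sum_i `|invmx D i i|.
exists (s * t) => [|x].
  by apply: mulr_ge0; apply: sumr_ge0 => j _ //; apply: sumr_ge0 => i _.
rewrite -mulrA; apply: qform_le_entries => i.
apply: le_trans (pdmx_entry_le x i Dpd) _.
apply: ler_wpM2r; first exact: pdmx_ge0.
apply: (le_trans (ler_norm _)); rewrite /t (bigD1 i)//= lerDl.
by apply: sumr_ge0.
Qed.

Lemma nbhs0_qform_lt n (P : 'M[R]_n) (r : R) : 0 < r ->
  nbhs (0 : 'cV[R]_n) [set x | qform P x < r].
Proof.
move=> r0; pose s := \sum_j \sum_i `|P i j|.
have s0 : 0 <= s by apply: sumr_ge0 => j _; apply: sumr_ge0 => i _.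
pose e := Num.min 1 (r / (s + 1)).
have s1 : 0 < s + 1 by lra.
have e0 : 0 < e by rewrite lt_min ltr01 divr_gt0.
apply/nbhs_ballP; exists e => //= x [_ xe].
have es : (s + 1) * e <= r.
  by rewrite mulrC -ler_pdivlMr// ge_min lexx orbT.
have e1 : e <= 1 by rewrite ge_min lexx.
have : qform P x <= s * e ^+ 2.
  apply: qform_le_entries => i; have := xe i 0.
  rewrite /ball /= mxE sub0r normrN => xie.
  by rewrite -[leLHS]real_normK ?num_real// lerXn2r ?nnegrE ?normr_ge0// ltW.
have : s * e ^+ 2 <= s * e by rewrite ler_wpM2l// expr2 ler_piMl// ltW.
by rewrite /=; nra.
Qed.

(** The open sublevel sets of a definite form are a basis of neighborhoods of
    the origin: every topological claim of the theorem is read off the values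
    of the terminal cost. *)
Lemma nbhs0_qformP n (P : 'M[R]_n) (O : set 'cV[R]_n) : pdmx P ->
  nbhs (0 : 'cV[R]_n) O <->
  exists2 r : R, 0 < r & forall x, qform P x < r -> O x.
Proof.
move=> Ppd; split; last first.
  by move=> [r r0 rO]; apply: filterS rO (nbhs0_qform_lt P r0).
move/nbhs_ballP => [e /= e0 eO]; pose t := 1 + \sum_i `|invmx P i i|.
have t0 : 0 < t by rewrite /t ltr_pwDl// sumr_ge0.
exists (e ^+ 2 / t); first by rewrite divr_gt0// exprn_gt0.
move=> x; rewrite ltr_pdivlMr// => xe; apply: eO; split=> // i j.
rewrite ord1 /ball /= mxE sub0r normrN -(@ltr_pXn2r _ 2)// ?nnegrE ?ltW//.
rewrite real_normK ?num_real//; apply: le_lt_trans (pdmx_entry_le x i Ppd) _.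
rewrite mulrC; apply: le_lt_trans xe.
apply: ler_wpM2l; first exact: pdmx_ge0.
apply: (le_trans (ler_norm _)); rewrite /t (bigD1 i)//= addrCA lerDl.
by rewrite addr_ge0// sumr_ge0.
Qed.

(** Continuity of [T] at the origin, seen on forms: the squared Euclidean
    length of [T x] is itself a quadratic form in [x]. *)
Lemma nbhs0_mulmx n p (T : 'M[R]_(p, n)) (O : set 'cV[R]_p) :
  nbhs (0 : 'cV[R]_p) O -> nbhs (0 : 'cV[R]_n) [set x | O (T *m x)].
Proof.
move/(nbhs0_qformP _ (pdmx_scalar1 R p)) => [r r0 rO].
apply: filterS (nbhs0_qform_lt (T^T *m 1%:M *m T) r0) => x /=.
by rewrite qform_cong; exact: rO.
Qed.

(** The decrease [P - C^T P C] is a definite form, hence dominates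
    [P / (k + 1)] for some [k]; so strict decrease of a quadratic function is
    automatically geometric. *)
Lemma lyapunov_contraction n (P C : 'M[R]_n) : pdmx P ->
  (forall x, x != 0 -> qform P (C *m x) < qform P x) ->
  exists rho : R, [/\ 0 <= rho, rho < 1 &
    forall x, qform P (C *m x) <= rho * qform P x].
Proof.
move=> Ppd dec; have [Ps _] := Ppd.
have Dpd : pdmx (P - C^T *m P *m C).
  split=> [|x /dec]; last by rewrite qformBmx qform_cong subr_gt0.
  by rewrite linearB /= !trmx_mul trmxK Ps mulmxA.
have [k k0 kP] := pdmx_dominates P Dpd.
(* k + 1 rather than k, which may vanish, makes the rate nonnegative *)
exists (1 - (k + 1)^-1); split=> [||x].
- by rewrite subr_ge0 invf_le1; lra.
- by rewrite ltrBlDr ltrDl invr_gt0; lra.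
have := kP x; have := pdmx_ge0 x Dpd; rewrite qformBmx qform_cong.
set p := qform P x; set q := qform P _ => pq pk.
have k1 : 0 < k + 1 by lra.
rewrite mulrBl mul1r lerBrDr -lerBrDl mulrC ler_pdivrMr//; nra.
Qed.

Lemma qform_iter_le n (P C : 'M[R]_n) (rho : R) : 0 <= rho ->
  (forall x, qform P (C *m x) <= rho * qform P x) ->
  forall t x, qform P (iter t (mulmx C) x) <= rho ^+ t * qform P x.
Proof.
move=> rho0 dec; elim=> [|t IHt] x; first by rewrite expr0 mul1r.
rewrite iterS exprS -mulrA; apply: le_trans (dec _) _.
exact: ler_wpM2l.
Qed.

Lemma lyapunov_stable n (P C : 'M[R]_n) : pdmx P ->
  (forall x, x != 0 -> qform P (C *m x) < qform P x) ->
  asymptotically_stable (fun x : 'cV[R]_n => C *m x) 0.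
Proof.
move=> Ppd dec.
have [rho [rho0 rho1 /(qform_iter_le rho0) iterV]] :=
  lyapunov_contraction Ppd dec.
split; first exact: mulmx0.
  move=> O /(nbhs0_qformP _ Ppd)[r r0 rO].
  apply/(nbhs0_qformP _ Ppd); exists r => // x xr t; apply: rO.
  apply: le_lt_trans (iterV t x) _; apply: le_lt_trans xr.
  by rewrite ler_piMl ?pdmx_ge0// exprn_ile1// ltW.
apply: (@filterS _ (nbhs (0 : 'cV[R]_n)) _ setT); last exact: filterT.
move=> x _ O /(nbhs0_qformP _ Ppd)[r r0 rO].
have : rho ^+ t * qform P x @[t --> \oo] --> 0.
  rewrite -[X in _ --> X](mul0r (qform P x)); apply: cvgM; last exact: cvg_cst.
  by apply: cvg_expr; rewrite ger0_norm.
move/cvgr_lt => /(_ _ r0); apply: filterS => t xr /=; apply: rO.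
exact: le_lt_trans (iterV t x) xr.
Qed.

End Lyapunov.

(** * The linear matrix inequality as a dissipation inequality *)

(** The Schur complement turns the block inequality into a bound on
    [G + G^T - S + W], and [qform_slack] trades the nonconvex quadratic
    [G^T S^-1 G] for the affine [G + G^T - S]. *)
Lemma lmi_decrease (R : realType) n p (G S W T : 'M[R]_n) (C : 'M[R]_(p, n)) :
  pdmx (block_mx (G + G^T - S + W) (row_mx T^T C^T)
                 (col_mx T C) (block_mx S 0 0 1%:M)) ->
  pdmx S /\ forall z,
    qform (invmx S) (T *m z) + qform 1%:M (C *m z)
    <= qform (invmx S) (G *m z) + qform W z ?= iff (z == 0).
Proof.
rewrite -tr_col_mx => /schur_pdmx[S1pd decr].
have [Spd _] := pdmx_block_diag S1pd; split=> // z.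
have [->|z0] := eqVneq z 0; first by rewrite !mulmx0 !qform0; exact/leif_refl.
have := qform_slack G z Spd; move: z0.
rewrite -(lt_leif (decr z)) mul_col_mx qform_inv_block_diag// invmx1 qformDmx.
move=> lt slack.
by split; [lra|apply/eqP; lra].
Qed.

(** * Block vectors and block matrices over the network *)

Section BlockForms.
Variables (R : realType) (M : nat).

Lemma qform_mxdiag (r : 'I_M -> nat) (X : forall i, 'M[R]_(r i)) x :
  qform (\mxdiag_(i < M) X i) x = \sum_i qform (X i) (submxcol x i).
Proof.
rewrite {1}/qform -{1 2}(submxcolK x) tr_mxcol mul_mxrow_mxdiag.
by rewrite mul_mxrow_mxcol summxE.
Qed.

Lemma pdmx_mxdiag (r : 'I_M -> nat) (X : forall i, 'M[R]_(r i)) :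
  (forall i, pdmx (X i)) -> pdmx (\mxdiag_(i < M) X i).
Proof.
move=> Xpd; split=> [|x x0].
  by rewrite tr_mxdiag; apply: eq_mxdiag => i; case: (Xpd i).
have X0 i : 0 <= qform (X i) (submxcol x i) by exact: pdmx_ge0.
rewrite qform_mxdiag lt_neqAle eq_sym sumr_ge0// andbT.
apply: contra x0 => /eqP/psumr_eq0P s0; apply/eqP.
rewrite -(submxcolK x) -[RHS]mxcol0; apply: eq_mxcol => i.
by apply: contra_eq (s0 (fun i _ => X0 i) i isT) => /(Xpd i).2/gt_eqF->.
Qed.

Lemma mul_blockdiag d (r : 'I_M -> nat) (X : forall i, 'M[R]_(r i, d))
    (x : 'cV[R]_(\sum_(j < M) d)) :
  blockdiag X *m x = \mxcol_(i < M) (X i *m submxcol x i).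
Proof.
rewrite -{1}(submxcolK x) /blockdiag mul_mxblock_mxrow; apply: eq_mxcol => i.
rewrite (bigD1 i)//= eqxx big1 ?addr0// => j; rewrite eq_sym => /negPf->.
exact: mul0mx.
Qed.

Variable N : 'I_M -> {set 'I_M}.

(** Putting subsystem [i] first only permutes the terms of a sum over [N i]. *)
Lemma trmx_selJ_nbvec (r : 'I_M -> nat) i (x : 'cV[R]_(\sum_(j < M) r j)) :
  i \in N i ->
  (selJ R N r i)^T *m nbvec N i x =
  \sum_(j in N i) (selE R r j)^T *m submxcol x j.
Proof.
move=> Ni; rewrite /selJ /nbvec tr_col_mx mul_row_col tr_mxcol mul_mxrow_mxcol.
rewrite [RHS](big_setD1 i)//=; congr (_ + _).
by rewrite [RHS]big_enum_val.
Qed.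

(** The products [AN] and [BN] only see the neighbors of [i]; the sparsity of
    the network makes them reproduce the full block row. *)
Lemma neighborhood_row (p r : 'I_M -> nat) i
    (X : forall i j, 'M[R]_(p i, r j)) (x : 'cV[R]_(\sum_(j < M) r j)) :
  i \in N i -> (forall j, j \notin N i -> X i j = 0) ->
  selE R p i *m \mxblock_(i < M, j < M) X i j *m (selJ R N r i)^T *m nbvec N i x
  = submxcol (\mxblock_(i < M, j < M) X i j *m x) i.
Proof.
move=> Ni X0; rewrite -[LHS]mulmxA trmx_selJ_nbvec// mulmx_sumr.
rewrite {1}/selE submxcol_mul mul1mx submxcol_matrix.
rewrite -submxcol_mul submxcol_matrix.
rewrite -{2}(submxcolK x) mul_mxrow_mxcol.
rewrite [RHS](bigID (mem (N i)))/= [X in _ = _ + X]big1 ?addr0; last first.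
  by move=> j /X0->; rewrite mul0mx.
apply: eq_bigr => j _; rewrite mulmxA; congr (_ *m _).
by rewrite /selE tr_submxcol trmx1 mul_submxrow mulmx1 mxrowK.
Qed.

End BlockForms.

(** * Decrease of the terminal cost along the closed loop *)

Section Dissipation.
Variables (R : realType) (M d : nat) (mi : 'I_M -> nat)
  (N : 'I_M -> {set 'I_M}).
Variables (Ab : forall i j : 'I_M, 'M[R]_(d, d))
  (Bb : forall i j : 'I_M, 'M[R]_(d, mi j)).
Hypotheses (hN : forall i, i \in N i)
  (hA : forall i j, j \notin N i -> Ab i j = 0)
  (hB : forall i j, j \notin N i -> Bb i j = 0).
Let A := \mxblock_(i < M, j < M) Ab i j.
Let B := \mxblock_(i < M, j < M) Bb i j.
Variables (Qh : 'I_M -> 'M[R]_d) (Rh : forall i : 'I_M, 'M[R]_(mi i)).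
Variable v : sdp_vars R d mi N.
Hypothesis hfeas : sdp_feasible A B Qh Rh v.

(** The program is linearized by the change of variables [x = G y] and
    [u = Y y], in which the feedback [u = Y G^-1 x] needs no inverse; the
    invertibility of [G] only follows afterwards. *)
Definition state_of (y : 'cV[R]_(\sum_(i < M) d)) :
    'cV[R]_(\sum_(i < M) d) := \mxcol_(i < M) (sdpG v *m submxcol y i).

Definition input_of (y : 'cV[R]_(\sum_(i < M) d)) :
    'cV[R]_(\sum_(i < M) mi i) := \mxcol_(i < M) (sdpY v i *m submxcol y i).

Lemma mul_GN i y : GN v i *m nbvec N i y = nbvec N i (state_of y).
Proof.
rewrite /GN /nbvec mul_block_col !mul0mx addr0 add0r /state_of mxcolK.
congr col_mx; rewrite /Grest mul_mxdiag_mxcol.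
by apply: eq_mxcol => l; rewrite mxcolK.
Qed.

(** This is where the consensus constraint on the copies of the gains acts:
    the neighbors of [i] apply the inputs that [i] assumes. *)
Lemma mul_YN i y : YN v i *m nbvec N i y = nbvec N i (input_of y).
Proof.
have [_ _ _ YnE _] := hfeas.
rewrite /YN /nbvec mul_block_col !mul0mx addr0 add0r /input_of mxcolK.
congr col_mx; rewrite mul_blockdiag.
by apply: eq_mxcol => l; rewrite !mxcolK YnE// enum_valP.
Qed.

Lemma mul_TN i y :
  TN A B v i *m nbvec N i y =
  col_mx (submxcol (A *m state_of y + B *m input_of y) i)
         (\mxcol_(l < degN N i) submxcol (state_of y) (nbr l)).
Proof.
rewrite /TN mul_col_mx mulmxDl -[AN _ _ _ *m _ *m _]mulmxA.
rewrite -[BN _ _ _ *m _ *m _]mulmxA mul_GN mul_YN submxcolD; congr col_mx.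
  congr (_ + _).
  - exact: (neighborhood_row (p := fun=> d) (r := fun=> d) _
      (hN i) (hA (i := i))).
  - exact: (neighborhood_row (p := fun=> d) _ (hN i) (hB (i := i))).
rewrite /GNi /nbvec mul_row_col mul0mx add0r /Grest mul_mxdiag_mxcol.
by apply: eq_mxcol => l; rewrite mxcolK.
Qed.

Lemma mul_Ti i y :
  Ti Qh Rh v i *m nbvec N i y =
  col_mx (Qh i *m submxcol (state_of y) i) (Rh i *m submxcol (input_of y) i).
Proof.
by rewrite /Ti /nbvec mul_block_col !mul0mx !addr0 !mxcolK !mulmxA.
Qed.

(** The terms weighted by [mu] in [SN] measure the neighbors' current states,
    which occur in both [GN] and the lower block of [TN]; they cancel. *)
Lemma lmi_local i :
  pdmx (sdpS v i) /\ forall y, let x := state_of y in let u := input_of y in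
    qform (invmx (sdpS v i)) (submxcol (A *m x + B *m u) i)
      + (qform 1%:M (Qh i *m submxcol x i) + qform 1%:M (Rh i *m submxcol u i))
    <= qform (invmx (sdpS v i)) (submxcol x i)
       + qform (sdpW v i) (nbvec N i y) ?= iff (nbvec N i y == 0).
Proof.
have [_ _ lmi_pd _ _] := hfeas.
have [SNpd decr] := lmi_decrease (lmi_pd i).
have [Sipd _] := pdmx_block_diag SNpd.
split=> // y x u; have := decr (nbvec N i y).
rewrite mul_GN mul_TN mul_Ti {1}(scalar_mx_block d (mi i) 1) qform_block_diag.
rewrite !qform_inv_block_diag// -/x -/u.
set c := qform _ (\mxcol_(l < _) _); set w := qform (sdpW v i) _.
by rewrite -addrA [c + _]addrC addrA [_ + c + w]addrAC (mono_leif (lerD2r c)).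
Qed.

Let Pg := \mxdiag_(i < M) invmx (sdpS v i).

Lemma pdmx_invS i : pdmx (invmx (sdpS v i)).
Proof. exact: pdmx_inv (lmi_local i).1. Qed.

Hypothesis hdelta : sdpdelta v <= 0.

Lemma qform_Wglobal_le0 y : qform (Wglobal v) y <= 0.
Proof.
have [_ _ _ _ [_ /(_ y)]] := hfeas; rewrite qformBmx subr_ge0.
move/le_trans; apply.
rewrite qform_scalar; apply: mulr_le0_ge0 => //.
by apply: sumr_ge0 => i _; exact: sqr_ge0.
Qed.

Lemma nbvec_eq0 (y : 'cV[R]_(\sum_(i < M) d)) :
  (forall i, nbvec N i y = 0) -> y = 0.
Proof.
move=> z0; rewrite -(submxcolK y) -[RHS]mxcol0; apply: eq_mxcol => i.
by have /eqP := z0 i; rewrite col_mx_eq0 => /andP[/eqP].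
Qed.

(** Summing [lmi_local], the coupling terms add up to the form of [Wglobal],
    which is nonpositive; strictness survives because some neighborhood vector
    of [y] is nonzero. *)
Lemma global_decrease y : y != 0 ->
  qform Pg (A *m state_of y + B *m input_of y)
    + \sum_i (qform 1%:M (Qh i *m submxcol (state_of y) i)
              + qform 1%:M (Rh i *m submxcol (input_of y) i))
  < qform Pg (state_of y).
Proof.
move=> y0; rewrite /Pg !qform_mxdiag -big_split/=.
have := qform_Wglobal_le0 y; rewrite /Wglobal qform_sum.
have WE i : qform ((Jn R d N i)^T *m sdpW v i *m Jn R d N i) y =
    qform (sdpW v i) (nbvec N i y).
  rewrite (qform_cong (sdpW v i) (Jn R d N i) y).
  by congr (qform _ _); exact: mul_selJ.
rewrite (eq_bigr _ (fun i _ => WE i)).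
move=> W0; have := leif_sum (fun i (_ : xpredT i) => (lmi_local i).2 y).
rewrite [X in _ <= X ?= iff _]big_split/= => /lt_leif /=.
have -> : [forall i, nbvec N i y == 0] = false.
  apply: contraNF y0 => /forallP z0; apply/eqP/nbvec_eq0 => i.
  exact/eqP/z0.
move/lt_le_trans; apply.
by rewrite gerDl.
Qed.

(** If [G y] vanished for some nonzero [y], the current cost would be zero,
    yet strictly larger than a nonnegative successor cost. *)
Lemma state_of_eq0 y : state_of y = 0 -> y = 0.
Proof.
move=> x0; apply/eqP/contraT => /global_decrease /=.
rewrite x0 qform0 ltNge => /negP[]; apply: addr_ge0.
  by apply: pdmx_ge0; apply: pdmx_mxdiag => i; exact: pdmx_invS.
by apply: sumr_ge0 => i _; rewrite addr_ge0// pdmx_ge0//; exact: pdmx_scalar1.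
Qed.

(** A kernel vector of [G], repeated in every block, is a kernel vector of
    [state_of].  The index [i] witnesses that there is a subsystem. *)
Lemma sdpG_unit (i : 'I_M) : sdpG v \in unitmx.
Proof.
rewrite -unitmx_tr -row_free_unit -kermx_eq0; apply/rowV0P => w /sub_kermxP wG.
have Gw : sdpG v *m w^T = 0 by rewrite -[sdpG v]trmxK -trmx_mul wG trmx0.
have y0 : \mxcol_(j < M) w^T = 0 :> 'cV[R]_(\sum_(j < M) d).
  apply: state_of_eq0; rewrite -[RHS]mxcol0.
  by apply: eq_mxcol => j; rewrite mxcolK.
by apply: trmx_inj; rewrite trmx0 -[LHS](mxcolK (fun=> w^T) i) y0 submxcol0.
Qed.

Let F i := sdpY v i *m invmx (sdpG v).

Lemma closed_loop_decrease x : x != 0 ->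
  qform Pg (A *m x + B *m (blockdiag F *m x))
    + \sum_i (qform 1%:M (Qh i *m submxcol x i)
              + qform 1%:M (Rh i *m submxcol (blockdiag F *m x) i))
  < qform Pg x.
Proof.
move=> x0; pose y := \mxcol_(i < M) (invmx (sdpG v) *m submxcol x i).
have xE : state_of y = x.
  rewrite -[RHS]submxcolK; apply: eq_mxcol => i.
  by rewrite mxcolK mulKVmx// (sdpG_unit i).
have uE : input_of y = blockdiag F *m x.
  rewrite mul_blockdiag; apply: eq_mxcol => i.
  by rewrite mxcolK mulmxA.
have /global_decrease/= : y != 0.
  apply: contra x0 => /eqP y0; rewrite -xE y0; apply/eqP.
  rewrite -[RHS]mxcol0; apply: eq_mxcol => i.
  by rewrite submxcol0 mulmx0.
by rewrite xE uE.
Qed.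

End Dissipation.

(** * Stability, decrease and invariance on a sublevel set *)

Theorem lemma2 (R : realType) (M d : nat) (mi : 'I_M -> nat)
    (N : 'I_M -> {set 'I_M})
    (Ab : forall i j : 'I_M, 'M[R]_(d, d))
    (Bb : forall i j : 'I_M, 'M[R]_(d, mi j))
    (U : forall i : 'I_M, set 'cV[R]_(mi i))
    (Q : 'I_M -> 'M[R]_d) (Rw : forall i : 'I_M, 'M[R]_(mi i))
    (Qh : 'I_M -> 'M[R]_d) (Rh : forall i : 'I_M, 'M[R]_(mi i))
    (hN : forall i, i \in N i)
    (hA : forall i j, j \notin N i -> Ab i j = 0)
    (hB : forall i j, j \notin N i -> Bb i j = 0)
    (hUcpt : forall i, compact (U i))
    (hUcvx : forall i, convex_set (U i))
    (hU0 : forall i, interior (U i) 0)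
    (hQ : forall i, psdmx (Q i)) (hR : forall i, pdmx (Rw i))
    (hQh : forall i, is_sqrtmx (Q i) (Qh i))
    (hRh : forall i, is_sqrtmx (Rw i) (Rh i))
    (A := \mxblock_(i < M, j < M) Ab i j)
    (B := \mxblock_(i < M, j < M) Bb i j)
    (v : sdp_vars R d mi N)
    (hfeas : sdp_feasible A B Qh Rh v)
    (hdelta : sdpdelta v <= 0) :
  exists (Omega : set 'cV[R]_(\sum_(i < M) d))
         (kappa : 'cV[R]_(\sum_(i < M) d) -> 'cV[R]_(\sum_(i < M) mi i))
         (lf : 'cV[R]_(\sum_(i < M) d) -> R)
         (F : forall i : 'I_M, 'M[R]_(mi i, d))
         (P : 'I_M -> 'M[R]_d),
    [/\ nbhs (0 : 'cV[R]_(\sum_(i < M) d)) Omega,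
        stabilizing A B kappa,
        [/\ forall x, kappa x = blockdiag F *m x,
            forall x, lf x = \sum_(i < M) qform (P i) (submxcol x i),
            forall i, pdmx (P i),
            forall i, sdpS v i \in unitmx /\ P i = invmx (sdpS v i)
          & forall i, sdpG v \in unitmx /\ F i = sdpY v i *m invmx (sdpG v)],
        forall x, Omega x ->
          lf (A *m x + B *m kappa x) - lf x
            + qform (\mxdiag_(i < M) Rw i) (kappa x)
            + qform (\mxdiag_(i < M) Q i) x <= 0
      & forall x, Omega x ->
          (forall i, U i (submxcol (kappa x) i))
          /\ Omega (A *m x + B *m kappa x)].
Proof.
set Pg := \mxdiag_(i < M) invmx (sdpS v i).
pose F i := sdpY v i *m invmx (sdpG v).
pose C := A + B *m blockdiag F.
have CE x : A *m x + B *m (blockdiag F *m x) = C *m x.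
  by rewrite mulmxDl !mulmxA.
have Ppd i : pdmx (invmx (sdpS v i)) by exact (pdmx_invS hN hA hB hfeas i).
have Pgpd : pdmx Pg by exact: pdmx_mxdiag.
have cost_ge0 x : 0 <= qform (\mxdiag_(i < M) Rw i) (blockdiag F *m x)
                       + qform (\mxdiag_(i < M) Q i) x.
  rewrite !qform_mxdiag addr_ge0// sumr_ge0// => i _.
    exact: pdmx_ge0.
  exact: (hQ i).2.
have decr x : x != 0 -> qform Pg (C *m x)
    + qform (\mxdiag_(i < M) Rw i) (blockdiag F *m x)
    + qform (\mxdiag_(i < M) Q i) x < qform Pg x.
  move=> x0; apply: le_lt_trans (closed_loop_decrease hN hA hB hfeas hdelta x0).
  rewrite CE -addrA lerD2l big_split/= addrC !qform_mxdiag.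
  apply: lerD; apply: ler_sum => i _.
    by rewrite (qform_sqrtmx _ (hQh i)).
  by rewrite (qform_sqrtmx _ (hRh i)).
have Pdecr x : x != 0 -> qform Pg (C *m x) < qform Pg x.
  by move=> x0; have := decr x x0; have := cost_ge0 x; lra.
have U_nbhs : nbhs (0 : 'cV[R]_(\sum_(i < M) d))
    [set x | forall i, U i (submxcol (blockdiag F *m x) i)].
  apply: (@filter_forall _ _
    (fun i => [set x | U i (submxcol (blockdiag F *m x) i)])
    (nbhs (0 : 'cV[R]_(\sum_(i < M) d)))) => i.
  have /nbhs0_mulmx := hU0 i.
  move=> /(_ _ (submxcol (blockdiag F) i)); apply: filterS => x /=.
  by rewrite submxcol_mul.
have [r r0 rU] := (nbhs0_qformP _ Pgpd).1 U_nbhs.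
exists [set x | qform Pg x < r], (fun x => blockdiag F *m x), (qform Pg), F,
  (fun i => invmx (sdpS v i)); split.
- exact: nbhs0_qform_lt.
- rewrite /stabilizing (_ : closed_loop _ _ _ = fun x => C *m x).
    exact: lyapunov_stable Pgpd Pdecr.
  by apply/funext => x; exact: CE.
- split=> // [x|i|i].
  + exact: qform_mxdiag.
  + split=> //; exact: pdmx_unit (lmi_local hN hA hB hfeas i).1.
  + by split=> //; exact (sdpG_unit hN hA hB hfeas hdelta i).
- move=> x _; rewrite CE; have [->|/decr] := eqVneq x 0; last by lra.
  by rewrite !mulmx0 !qform0 subrr !addr0.
- move=> x /= xr; split=> [i|]; first exact: rU.
  rewrite CE; have [x0|/Pdecr/lt_trans] := eqVneq x 0; last exact.
  by rewrite x0 mulmx0 qform0.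
Qed.
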